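(* Let $d\ge 2$, let $X\in\mathbb R^{n_1\times\cdots\times n_d}$, and let $\hat X$ be a TT-CROSS-DEIM approximation of $X$ with TT cores $G_1,\dots,G_d$, TT ranks $r_1,\dots,r_{d-1}$, and interpolation index sets $\mathcal I_p=\{(i_1^{(\alpha_p)},\dots,i_p^{(\alpha_p)})\}_{\alpha_p=1}^{r_p}$ and $\mathcal J_p=\{(i_{p+1}^{(\alpha_p)},\dots,i_d^{(\alpha_p)})\}_{\alpha_p=1}^{r_p}$, $p=1,\dots,d-1$. Assume the interpolatory property, i.e. that $\hat X$ and $X$ coincide on the selected fibers: $$\hat X(:,\mathcal J_1)=X(:,\mathcal J_1),\qquad \hat X(\mathcal I_{p-1},:,\mathcal J_p)=X(\mathcal I_{p-1},:,\mathcal J_p)\ (2\le p\le d-1),\qquad \hat X(\mathcal I_{d-1},:)=X(\mathcal I_{d-1},:).$$ Assume also that for every $p=1,\dots,d-1$ the $r_p\times r_p$ contraction matrices $\mathbf L_p$, whose $\alpha_p$-th row is $G_1(1,i_1^{(\alpha_p)},:)\cdots G_p(:,i_p^{(\alpha_p)},:)$ with indices from $\mathcal I_p$, and $\mathbf R_p$, whose $\alpha_p$-th column is $G_{p+1}(:,i_{p+1}^{(\alpha_p)},:)\cdots G_d(:,i_d^{(\alpha_p)},1)$ with indices from $\mathcal J_p$, are nonsingular. Then every fiber of $\hat X$ is a linear combination of the selected fibers of $X$: (a) for all $i_2,\dots,i_d$ there is a vector $\mathbf z_{r_1}\in\mathbb R^{r_1}$ with $$\hat X(:,i_2,\dots,i_d)=\sum_{\alpha_1=1}^{r_1}X\big(:,i_2^{(\alpha_1)},\dots,i_d^{(\alpha_1)}\big)\,\mathbf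 z_{r_1}(\alpha_1);$$ (b) for every $2\le p\le d-1$ and all $i_1,\dots,i_{p-1},i_{p+1},\dots,i_d$ there are vectors $\mathbf z_{l_p}\in\mathbb R^{r_{p-1}}$ and $\mathbf z_{r_p}\in\mathbb R^{r_p}$ with $$\hat X(i_1,\dots,i_{p-1},:,i_{p+1},\dots,i_d)=\sum_{\alpha_{p-1}=1}^{r_{p-1}}\sum_{\alpha_p=1}^{r_p}\mathbf z_{l_p}(\alpha_{p-1})\,X\big(i_1^{(\alpha_{p-1})},\dots,i_{p-1}^{(\alpha_{p-1})},:,i_{p+1}^{(\alpha_p)},\dots,i_d^{(\alpha_p)}\big)\,\mathbf z_{r_p}(\alpha_p);$$ (c) for all $i_1,\dots,i_{d-1}$ there is a vector $\mathbf z_{l_d}\in\mathbb R^{r_{d-1}}$ with $$\hat X(i_1,\dots,i_{d-1},:)=\sum_{\alpha_{d-1}=1}^{r_{d-1}}\mathbf z_{l_d}(\alpha_{d-1})\,X\big(i_1^{(\alpha_{d-1})},\dots,i_{d-1}^{(\alpha_{d-1})},:\big).$$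
   Context: A tensor $\hat X\in\mathbb R^{n_1\times\cdots\times n_d}$ has TT cores $G_p\in\mathbb R^{r_{p-1}\times n_p\times r_p}$, $p=1,\dots,d$, with $r_0=r_d=1$, if $$\hat X(i_1,\dots,i_d)=\sum_{\alpha_1=1}^{r_1}\cdots\sum_{\alpha_{d-1}=1}^{r_{d-1}}G_1(1,i_1,\alpha_1)G_2(\alpha_1,i_2,\alpha_2)\cdots G_d(\alpha_{d-1},i_d,1)$$ for all indices. $G_p(:,i_p,:)$ denotes the $r_{p-1}\times r_p$ matrix slice, $G_1(1,i_1,:)$ is a row vector and $G_d(:,i_d,1)$ is a column vector. A colon in an index position means that all indices of that mode are retained. A fiber is the vector obtained by fixing all indices but one. For lists of tuples $\mathcal I_{p-1}$ (indices of modes $1,\dots,p-1$) and $\mathcal J_p$ (indices of modes $p+1,\dots,d$), $X(\mathcal I_{p-1},:,\mathcal J_p)$ denotes the $r_{p-1}\times n_p\times r_p$ subtensor obtained by restricting the first $p-1$ modes to the tuples in $\mathcal I_{p-1}$ and the last $d-p$ modes to the tuples in $\mathcal J_p$; $X(:,\mathcal J_1)$ and $X(\mathcal I_{d-1},:)$ are defined analogously. A TT-CROSS-DEIM approximation is a TT tensor built from $X$ by successive CUR/DEIM cross approximations of unfoldings, using left index tuples $\mathcal I_p$ and right index tuples $\mathcal J_p$. For this statement the only properties of it that are used are its TT form, its interpolation index sets, the interpolatory property and the nonsingularity of $\mathbf L_p,\mathbf R_p$ listed in the claim. *)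

(* Defs.v *)
From mathcomp Require Import all_boot all_order all_algebra.
From mathcomp Require Import reals.

Set Implicit Arguments.
Unset Strict Implicit.
Unset Printing Implicit Defensive.

Import Order.TTheory GRing.Theory Num.Theory.
Local Open Scope ring_scope.

(* Modes, and the entries of each mode, are numbered from 0: mode k here is    *)
(* mode k + 1 in the usual 1-based numbering.  Cut p, for 0 < p < d, separates *)
(* the modes q < p from the modes p <= q, so the ranks r p and the index sets  *)
(* I_p, J_p keep their usual numbers.  The families n and r, and the cores G,  *)
(* are indexed by all of nat, but only n q and G q with q < d, and r p with    *)
(* p <= d, are ever used for a tensor of order d.                              *)

(* Tuples of indices of the modes q with a <= q < b. *)
Definition mindex (n : nat -> nat) (a b : nat) : Type :=
  forall q : nat, (a <= q < b)%N -> 'I_(n q).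

Definition tensor (R : Type) (n : nat -> nat) (d : nat) : Type :=
  mindex n 0 d -> R.

(* G q x is the slice G_{q+1}(:, x, :). *)
Definition tt_cores (R : Type) (n r : nat -> nat) : Type :=
  forall q : nat, 'I_(n q) -> 'M[R]_(r q, r q.+1).

Lemma mindex_emptyP (a b q : nat) : (b <= a)%N -> (a <= q < b)%N -> False.
Proof. by move=> ba /andP[/(leq_trans ba)]; rewrite leqNgt => /negP. Qed.

Definition mempty (n : nat -> nat) (a b : nat) (ba : (b <= a)%N) :
    mindex n a b :=
  fun q hq => False_rect _ (mindex_emptyP ba hq).

Lemma mindex_beltP (a b q : nat) : (a <= q < b)%N -> (a <= q < b.+1)%N.
Proof. by case/andP=> -> /ltnW. Qed.

Definition mbelast (n : nat -> nat) (a b : nat) (i : mindex n a b.+1) :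
    mindex n a b :=
  fun q hq => i q (mindex_beltP hq).

Lemma mindex_lastP (a b : nat) : (a <= b)%N -> (a <= b < b.+1)%N.
Proof. by move=> ->; rewrite ltnSn. Qed.

Lemma mindex_leftP (k q : nat) : (q < k)%N -> (0 <= q < k)%N.
Proof. by []. Qed.

Lemma mindex_rightP (d k q : nat) :
  (k < q)%N -> (0 <= q < d)%N -> (k.+1 <= q < d)%N.
Proof. by move=> -> /andP[_ ->]. Qed.

(* The index (a, x, b) of a tensor of order d, with x in mode k. *)
Definition msplice (n : nat -> nat) (d k : nat)
    (a : mindex n 0 k) (x : 'I_(n k)) (b : mindex n k.+1 d) : mindex n 0 d :=
  fun q hq =>
    match ltngtP q k with
    | CompareNatLt qk => a q (mindex_leftP qk)
    | CompareNatGt kq => b q (mindex_rightP kq hq)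
    | CompareNatEq qk => cast_ord (congr1 n (esym qk)) x
    end.

(* The fiber X(a, :, b). *)
Definition fiber (R : Type) (n : nat -> nat) (d k : nat) (X : tensor R n d)
    (a : mindex n 0 k) (b : mindex n k.+1 d) : 'cV[R]_(n k) :=
  \col_x X (msplice a x b).

Lemma mindex_ordP (d : nat) (q : 'I_d) : (0 <= q < d)%N.
Proof. exact: ltn_ord. Qed.

(* When r 0 = r d = 1, the components g 0 and g d of g take a single value, so *)
(* this is the sum over g 1, ..., g (d - 1) only.                              *)
Definition tt_tensor (R : realType) (n r : nat -> nat) (d : nat)
    (G : tt_cores R n r) : tensor R n d :=
  fun i => \sum_(g : {dffun forall p : 'I_d.+1, 'I_(r p)})
    \prod_(q < d) G q (i q (mindex_ordP q)) (g (widen_ord (leqnSn d) q))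
                    (g (lift ord0 q)).

(* The matrix product of the slices G q (i q) over a <= q < b, from left to    *)
(* right.  When a = b, pid_mx (r a) is the identity matrix; pid_mx only serves *)
(* to avoid a cast, and its value when b < a is irrelevant.                    *)
Fixpoint tt_prod (R : realType) (n r : nat -> nat) (G : tt_cores R n r)
    (a b : nat) : mindex n a b -> 'M[R]_(r a, r b) :=
  match b return mindex n a b -> 'M[R]_(r a, r b) with
  | 0%N => fun _ => pid_mx (r a)
  | b'.+1 => fun i =>
      match @idP (a <= b')%N with
      | ReflectT ab =>
          tt_prod G (mbelast i) *m G b' (i b' (mindex_lastP ab))
      | ReflectF _ => pid_mx (r a)
      end
  end.

Definition only_ord (m : nat) (m1 : m = 1%N) : 'I_m := cast_ord (esym m1) ord0.

(* For the contraction matrices, I and J list the r p tuples of I_p and J_p.   *)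
Definition contrL (R : realType) (n r : nat -> nat) (G : tt_cores R n r)
    (r0 : r 0%N = 1%N) (p : nat) (I : 'I_(r p) -> mindex n 0 p) : 'M[R]_(r p) :=
  \matrix_(s, t) tt_prod G (I s) (only_ord r0) t.

Definition contrR (R : realType) (n r : nat -> nat) (G : tt_cores R n r)
    (d : nat) (rd : r d = 1%N) (p : nat) (J : 'I_(r p) -> mindex n p d) :
    'M[R]_(r p) :=
  \matrix_(s, t) tt_prod G (J t) s (only_ord rd).

Lemma cut_first (d : nat) : (1 < d)%N -> (0 < 1 < d)%N.
Proof. by []. Qed.

Lemma cut_last (d : nat) : (1 < d)%N -> (0 < d.-1 < d)%N.
Proof. by case: d => [|[|d]] //= _; rewrite ltnSn. Qed.

(* Main.v *)
Require Import Defs.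
From mathcomp Require Import all_boot all_order all_algebra.
From mathcomp Require Import reals.

Set Implicit Arguments.
Unset Strict Implicit.
Unset Printing Implicit Defensive.

Import Order.TTheory GRing.Theory Num.Theory.
Local Open Scope ring_scope.

(** Each entry of a TT tensor is a product of slices, so it factors at mode [k]
as [u(i) G_k(x) v(j)], where the row [u(i)] depends only on the indices [i] of
the modes before [k], and the column [v(j)] only on the indices [j] of the modes
after [k].  The rows of the matrix [L] of cut [k] are the vectors [u(I_a)] of the
selected left tuples, and the columns of the matrix [R] of cut [k + 1] are the
vectors [v(J_b)] of the selected right tuples.  As [L] is invertible, [u(i)] is a
combination of the [u(I_a)], with coefficients [u(i) L^-1] which depend neither
on [x] nor on [j]; by linearity, the fiber at [(i, j)] is the same combination of
the fibers at [(I_a, j)] ([fiber_left_interp]).  Likewise on the right, with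
coefficients [R^-1 v(j)] ([fiber_right_interp]).  One of these steps gives the
first and the last mode, both of them give the middle modes, and the combination
obtained involves only selected fibers, on which the two tensors agree.

The TT form is given as a sum over all rank indices at once, with a range for
each index that depends on its position; [sum_tt_paths] identifies this sum with
the matrix product, and [tt_prod_msplice] cuts the product at mode [k]. *)

(** * Entries of a spliced multi-index *)

Lemma msplice_lt (n : nat -> nat) (d k : nat) (a : mindex n 0 k) (x : 'I_(n k))
    (b : mindex n k.+1 d) (q : nat) (hq : (0 <= q < d)%N) (qk : (0 <= q < k)%N) :
  msplice a x b hq = a q qk.
Proof.
rewrite /msplice; case: (ltngtP q k) => [lt|gt|eq].
- by rewrite (bool_irrelevance (mindex_leftP lt) qk).
- by exfalso; have := ltn_trans gt qk; rewrite ltnn.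
- by exfalso; have : (q < k)%N by []; rewrite eq ltnn.
Qed.

Lemma msplice_gt (n : nat -> nat) (d k : nat) (a : mindex n 0 k) (x : 'I_(n k))
    (b : mindex n k.+1 d) (q : nat) (hq : (0 <= q < d)%N)
    (kq : (k.+1 <= q < d)%N) :
  msplice a x b hq = b q kq.
Proof.
have kltq : (k < q)%N by case/andP: (kq).
rewrite /msplice; case: (ltngtP q k) => [lt|gt|eq].
- by exfalso; have := ltn_trans lt kltq; rewrite ltnn.
- by rewrite (bool_irrelevance (mindex_rightP gt hq) kq).
- by exfalso; have := kltq; rewrite eq ltnn.
Qed.

Lemma msplice_eq (n : nat -> nat) (d k : nat) (a : mindex n 0 k) (x : 'I_(n k))
    (b : mindex n k.+1 d) (hk : (0 <= k < d)%N) :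
  msplice a x b hk = x.
Proof.
rewrite /msplice; case: (ltngtP k k) => [lt|gt|eq].
- by exfalso; rewrite ltnn in lt.
- by exfalso; rewrite ltnn in gt.
- by apply: val_inj.
Qed.

(** * Products of slices *)

Section Cores.

Variables (R : realType) (n r : nat -> nat) (G : tt_cores R n r).

(** Needed because two multi-indices built in different ways are equal only
entrywise: they carry different proofs of the bounds. *)
Lemma eq_tt_prod (a b : nat) (i j : mindex n a b) :
  (forall q hq, i q hq = j q hq) -> tt_prod G i = tt_prod G j.
Proof.
elim: b i j => [//|b IHb] i j eq_ij /=.
case: {-}_ / idP => // ab; rewrite eq_ij.
by congr (_ *m _); apply: IHb => q hq; apply: eq_ij.
Qed.

Lemma tt_prod_nil (a : nat) (i : mindex n a a) : tt_prod G i = 1%:M.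
Proof.
case: a i => [|a] i /=; first exact: pid_mx_1.
case: {-}_ / idP => [aa|_]; last exact: pid_mx_1.
by exfalso; rewrite ltnn in aa.
Qed.

Lemma tt_prod_recr (a b : nat) (i : mindex n a b.+1) (ab : (a <= b)%N)
    (hb : (a <= b < b.+1)%N) :
  tt_prod G i = tt_prod G (mbelast i) *m G (i b hb).
Proof.
rewrite /=; case: {-}_ / idP => // ab'.
by rewrite (bool_irrelevance (mindex_lastP ab') hb).
Qed.

Lemma tt_prod_msplice (d k : nat) (kd : (k < d)%N) (a : mindex n 0 k)
    (x : 'I_(n k)) (b : mindex n k.+1 d) :
  tt_prod G (msplice a x b) = tt_prod G a *m G x *m tt_prod G b.
Proof.
elim: d kd b => [//|d IHd]; rewrite ltnS leq_eqVlt => /orP[/eqP eq_kd|kd] b.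
  subst d; rewrite tt_prod_nil mulmx1.
  rewrite (tt_prod_recr _ (leq0n k) (mindex_lastP (leq0n k))) msplice_eq.
  by congr (_ *m _); apply: eq_tt_prod => q hq; apply: msplice_lt.
rewrite (tt_prod_recr _ (leq0n d) (mindex_lastP (leq0n d))).
rewrite (tt_prod_recr b kd (mindex_lastP kd)) mulmxA -IHd //.
rewrite (msplice_gt _ _ _ _ (mindex_lastP kd)).
congr (_ *m _); apply: eq_tt_prod => q hq.
case: (ltngtP q k) => [lt|gt|eq].
- by rewrite /mbelast !(msplice_lt _ _ _ _ (mindex_leftP lt)).
- rewrite (msplice_gt _ _ _ _ (mindex_rightP gt hq)) /mbelast.
  by rewrite (msplice_gt _ _ _ _ (mindex_beltP (mindex_rightP gt hq))).
- by subst q; rewrite /mbelast !msplice_eq.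
Qed.

(** * From the sum over rank indices to the product of slices *)

Lemma ord_not_ltn (d : nat) (p : 'I_d.+1) : ~ (p < d)%N -> d = p.
Proof.
by move/negP; rewrite -leqNgt => dp; apply/anti_leq; rewrite dp leq_ord.
Qed.

(** The path of rank indices [g 0, ..., g (d - 1), t]; the cast moves [t] to
position [p] once [p] is known to be [d]. *)
Definition dffun_rcons (d : nat) (g : {dffun forall p : 'I_d, 'I_(r p)})
    (t : 'I_(r d)) : {dffun forall p : 'I_d.+1, 'I_(r p)} :=
  [ffun p : 'I_d.+1 =>
    match @idP (p < d)%N return 'I_(r p) with
    | ReflectT pd => g (Ordinal pd)
    | ReflectF not_pd => cast_ord (congr1 r (ord_not_ltn not_pd)) t
    end].

Lemma dffun_rcons_lt (d : nat) (g : {dffun forall p : 'I_d, 'I_(r p)})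
    (t : 'I_(r d)) (p : 'I_d.+1) (pd : (p < d)%N) :
  dffun_rcons g t p = g (Ordinal pd).
Proof.
rewrite ffunE; case: {-}_ / idP => // pd'.
by rewrite (bool_irrelevance pd' pd).
Qed.

Lemma dffun_rcons_last (d : nat) (g : {dffun forall p : 'I_d, 'I_(r p)})
    (t : 'I_(r d)) (hd : (d < d.+1)%N) :
  dffun_rcons g t (Ordinal hd) = t.
Proof.
rewrite ffunE; case: {-}_ / idP => [dd|?]; last exact: val_inj.
by exfalso; rewrite /= ltnn in dd.
Qed.

Lemma big_dffun_rcons (d : nat)
    (F : {dffun forall p : 'I_d.+1, 'I_(r p)} -> R) :
  \sum_g F g = \sum_g \sum_t F (dffun_rcons g t).
Proof.
rewrite pair_big /=.
pose restrict (g : {dffun forall p : 'I_d.+1, 'I_(r p)}) :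
    {dffun forall p : 'I_d, 'I_(r p)} * 'I_(r d) :=
  ([ffun p : 'I_d => g (widen_ord (leqnSn d) p) : 'I_(r p)], g ord_max).
rewrite (reindex (fun u => dffun_rcons u.1 u.2)) //=.
exists restrict => [[g t] _|g _].
  congr pair; last exact: dffun_rcons_last.
  apply/ffunP => -[p pd]; rewrite ffunE.
  exact: (@dffun_rcons_lt _ _ _ (widen_ord (leqnSn d) (Ordinal pd))).
apply/ffunP => -[p hp].
have := hp; rewrite ltnS leq_eqVlt => /orP[/eqP eq_pd|pd].
  subst p; rewrite dffun_rcons_last /= /ord_max.
  by rewrite (bool_irrelevance (ltnSn d) hp).
rewrite dffun_rcons_lt ffunE /widen_ord /=.
by rewrite (bool_irrelevance hp (widen_ord_proof (Ordinal pd) (leqnSn d))).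
Qed.

(** Induction on [d] peels off the last rank index, as the matrix product peels
off its last slice.  The weight [w] on that index is what makes the induction go
through: the slice that is peeled off is absorbed in the weight. *)
Lemma sum_tt_paths (d : nat) (i : mindex n 0 d) (w : 'I_(r d) -> R) :
  \sum_(g : {dffun forall p : 'I_d.+1, 'I_(r p)})
     (\prod_(q < d) G (i q (mindex_ordP q)) (g (widen_ord (leqnSn d) q))
                      (g (lift ord0 q))) * w (g ord_max)
  = \sum_s \sum_t tt_prod G i s t * w t.
Proof.
elim: d i w => [|d IHd] i w; rewrite big_dffun_rcons.
  have g0 : {dffun forall p : 'I_0, 'I_(r p)}.
    by apply: finfun => -[].
  rewrite (big_pred1 g0) => [|g]; last first.
    by apply/esym/eqP/ffunP => -[].
  apply: eq_bigr => s _; rewrite big_ord0 mul1r dffun_rcons_last tt_prod_nil.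
  rewrite (bigD1 s) //= big1 => [|t ts]; last first.
    by rewrite mxE eq_sym (negbTE ts) mul0r.
  by rewrite mxE eqxx mul1r addr0.
pose x := i d (mindex_lastP (leq0n d)).
(* Summing over the last rank index turns [w] into the weight [G x *m w]. *)
rewrite (eq_bigr (fun g : {dffun forall p : 'I_d.+1, 'I_(r p)} =>
    (\prod_(q < d) G (mbelast i (mindex_ordP q)) (g (widen_ord (leqnSn d) q))
                      (g (lift ord0 q)))
    * \sum_t G x (g ord_max) t * w t)) => [|g _]; last first.
  rewrite mulr_sumr; apply: eq_bigr => t _.
  rewrite dffun_rcons_last big_ord_recr /= -mulrA; congr (_ * (_ * _)).
    apply: eq_bigr => q _.
    (* The factor of a mode [q < d] sees only entries of [g]. *)
    rewrite (@dffun_rcons_lt _ g t (widen_ord _ (widen_ord _ q))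
               (widen_ord_proof q (leqnSn d))).
    rewrite (@dffun_rcons_lt _ g t (lift ord0 (widen_ord _ q))
               (@lift_subproof d.+1 ord0 q)).
    rewrite /mbelast.
    by rewrite (bool_irrelevance (mindex_ordP (widen_ord _ _))
                  (mindex_beltP (mindex_ordP q))).
  rewrite (@dffun_rcons_lt _ g t (widen_ord _ ord_max) (ltnSn d)).
  rewrite [dffun_rcons g t (lift _ _)]dffun_rcons_last.
  by rewrite (bool_irrelevance (mindex_ordP ord_max) (mindex_lastP (leq0n d))).
rewrite (IHd (mbelast i) (fun u => \sum_t G x u t * w t)).
apply: eq_bigr => s _.
rewrite (tt_prod_recr _ (leq0n d) (mindex_lastP (leq0n d))).
under eq_bigr do rewrite mulr_sumr.
rewrite exchange_big /=; apply: eq_bigr => t _.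
by rewrite mxE mulr_suml; apply: eq_bigr => u _; rewrite mulrA.
Qed.

Lemma only_ord_unique (m : nat) (m1 : m = 1%N) (s : 'I_m) : s = only_ord m1.
Proof. by subst m; rewrite [s]ord1; apply: val_inj. Qed.

Lemma big_only_ord (m : nat) (m1 : m = 1%N) (F : 'I_m -> R) :
  \sum_s F s = F (only_ord m1).
Proof.
by apply: big_pred1 => s; rewrite [s](only_ord_unique m1) /= eqxx.
Qed.

(** * Interpolation of fibers *)

Section Interpolation.

Variables (d : nat) (r0 : r 0%N = 1%N) (rd : r d = 1%N).

Local Notation ttG := (@tt_tensor R n r d G).

Lemma tt_tensorE (i : mindex n 0 d) :
  tt_tensor G i = tt_prod G i (only_ord r0) (only_ord rd).
Proof.
have := sum_tt_paths i (fun=> 1).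
rewrite (big_only_ord r0) (big_only_ord rd) mulr1 => <-.
by apply: eq_bigr => g _; rewrite mulr1.
Qed.

Lemma fiber_rowE (k : nat) (kd : (k < d)%N) (a : mindex n 0 k)
    (b : mindex n k.+1 d) (x : 'I_(n k)) :
  fiber ttG a b x 0
  = (row (only_ord r0) (tt_prod G a) *m (G x *m tt_prod G b)) 0 (only_ord rd).
Proof.
by rewrite mxE tt_tensorE tt_prod_msplice // -row_mul [RHS]mxE mulmxA.
Qed.

Lemma fiber_colE (k : nat) (kd : (k < d)%N) (a : mindex n 0 k)
    (b : mindex n k.+1 d) (x : 'I_(n k)) :
  fiber ttG a b x 0
  = (tt_prod G a *m G x *m col (only_ord rd) (tt_prod G b)) (only_ord r0) 0.
Proof.
by rewrite mxE tt_tensorE tt_prod_msplice // colE mulmxA -colE [RHS]mxE.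
Qed.

(** The coefficients are the coordinates of the row vector of [i] in the basis
formed by the rows of the left contraction matrix.  They do not depend on [b]:
this lets the middle modes combine this lemma with its right counterpart. *)
Lemma fiber_left_interp (k : nat) (kd : (k < d)%N)
    (I : 'I_(r k) -> mindex n 0 k) (i : mindex n 0 k) :
  contrL G r0 I \in unitmx ->
  exists zl : 'cV[R]_(r k), forall b : mindex n k.+1 d,
    fiber ttG i b
    = \sum_(a < r k) zl a 0 *: fiber ttG (I a) b.
Proof.
move=> L_unit.
pose u := row (only_ord r0) (tt_prod G i) *m invmx (contrL G r0 I).
have row_i : row (only_ord r0) (tt_prod G i)
    = \sum_a u 0 a *: row (only_ord r0) (tt_prod G (I a)).
  rewrite -[LHS](mulmxKV L_unit) mulmx_sum_row; apply: eq_bigr => a _.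
  by congr (_ *: _); apply/rowP => t; rewrite !mxE.
exists u^T => b; apply/colP => x.
rewrite fiber_rowE // row_i mulmx_suml !summxE; apply: eq_bigr => a _.
by rewrite -scalemxAl [LHS]mxE -fiber_rowE // [RHS]mxE [u^T _ _]mxE.
Qed.

(** The mirror image: coordinates in the basis formed by the columns of the right
contraction matrix, independent of [a]. *)
Lemma fiber_right_interp (k : nat) (kd : (k < d)%N)
    (J : 'I_(r k.+1) -> mindex n k.+1 d) (j : mindex n k.+1 d) :
  contrR G rd J \in unitmx ->
  exists zr : 'cV[R]_(r k.+1), forall a : mindex n 0 k,
    fiber ttG a j
    = \sum_(b < r k.+1) zr b 0 *: fiber ttG a (J b).
Proof.
move=> R_unit.
pose v := invmx (contrR G rd J) *m col (only_ord rd) (tt_prod G j).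
have col_j : col (only_ord rd) (tt_prod G j)
    = \sum_b v b 0 *: col (only_ord rd) (tt_prod G (J b)).
  rewrite -[LHS](mulKVmx R_unit); apply/colP => s; rewrite mxE summxE.
  by apply: eq_bigr => b _; rewrite !mxE mulrC.
exists v => a; apply/colP => x.
rewrite fiber_colE // col_j mulmx_sumr !summxE; apply: eq_bigr => b _.
by rewrite -scalemxAr [LHS]mxE -fiber_colE // [RHS]mxE.
Qed.

End Interpolation.

End Cores.

Theorem mainTheorem2 (R : realType) (d : nat) (hd : (1 < d)%N)
  (n r : nat -> nat) (r0 : r 0%N = 1%N) (rd : r d = 1%N)
  (X Xh : tensor R n d) (G : tt_cores R n r)
  (hTT : forall i : mindex n 0 d, Xh i = tt_tensor G i)
  (I : forall p : nat, (0 < p < d)%N -> 'I_(r p) -> mindex n 0 p)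
  (J : forall p : nat, (0 < p < d)%N -> 'I_(r p) -> mindex n p d)
  (hfirst : forall b : 'I_(r 1%N),
     fiber Xh (mempty n (leqnn 0)) (J 1%N (cut_first hd) b)
     = fiber X (mempty n (leqnn 0)) (J 1%N (cut_first hd) b))
  (hmid : forall (k : nat) (hk : (0 < k < d)%N) (hk1 : (0 < k.+1 < d)%N)
     (a : 'I_(r k)) (b : 'I_(r k.+1)),
     fiber Xh (I k hk a) (J k.+1 hk1 b) = fiber X (I k hk a) (J k.+1 hk1 b))
  (hlast : forall a : 'I_(r d.-1),
     fiber Xh (I d.-1 (cut_last hd) a) (mempty n (leqSpred d))
     = fiber X (I d.-1 (cut_last hd) a) (mempty n (leqSpred d)))
  (hL : forall (p : nat) (hp : (0 < p < d)%N), contrL G r0 (I p hp) \in unitmx)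
  (hR : forall (p : nat) (hp : (0 < p < d)%N), contrR G rd (J p hp) \in unitmx) :
  [/\ forall j : mindex n 1 d,
        exists zr : 'cV[R]_(r 1%N),
          fiber Xh (mempty n (leqnn 0)) j
          = \sum_(b < r 1%N)
              zr b 0 *: fiber X (mempty n (leqnn 0)) (J 1%N (cut_first hd) b),
      forall (k : nat) (hk : (0 < k < d)%N) (hk1 : (0 < k.+1 < d)%N)
        (i : mindex n 0 k) (j : mindex n k.+1 d),
        exists (zl : 'cV[R]_(r k)) (zr : 'cV[R]_(r k.+1)),
          fiber Xh i j
          = \sum_(a < r k) \sum_(b < r k.+1)
              (zl a 0 * zr b 0) *: fiber X (I k hk a) (J k.+1 hk1 b)
    & forall i : mindex n 0 d.-1,
        exists zl : 'cV[R]_(r d.-1),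
          fiber Xh i (mempty n (leqSpred d))
          = \sum_(a < r d.-1)
              zl a 0 *: fiber X (I d.-1 (cut_last hd) a) (mempty n (leqSpred d))].
Proof.
have XhE k (a : mindex n 0 k) (b : mindex n k.+1 d) :
    fiber Xh a b = fiber (@tt_tensor R n r d G) a b.
  by apply/colP => x; rewrite !mxE hTT.
split=> [j|k hk hk1 i j|i].
- have [zr Ezr] := fiber_right_interp r0 (ltnW hd) j (hR _ (cut_first hd)).
  exists zr; rewrite XhE Ezr; apply: eq_bigr => b _.
  by rewrite -hfirst XhE.
- have kd : (k < d)%N by case/andP: hk.
  have [zl Ezl] := fiber_left_interp rd kd i (hL _ hk).
  have [zr Ezr] := fiber_right_interp r0 kd j (hR _ hk1).
  exists zl, zr; rewrite XhE Ezl; apply: eq_bigr => a _.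
  rewrite Ezr scaler_sumr; apply: eq_bigr => b _.
  by rewrite -hmid XhE scalerA.
- have dd : (d.-1 < d)%N by case/andP: (cut_last hd).
  have [zl Ezl] := fiber_left_interp rd dd i (hL _ (cut_last hd)).
  exists zl; rewrite XhE Ezl; apply: eq_bigr => a _.
  by rewrite -hlast XhE.
Qed.
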